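(* Let $\mathbf{I} = (X,f,x_0)$ be a minimal iterator with $\omega$ the assignment of finite sets in $\mathbf{I}$, and let $\oplus$ be the unique binary operation on $X$ such that $\omega(A) \oplus \omega(B) = \omega(A \cup B)$ whenever $A$ and $B$ are disjoint finite sets. There exists a unique binary operation $\otimes$ on $X$ such that $$\omega(A) \otimes \omega(B) = \omega(A\times B)$$ for all finite sets $A$ and $B$. This operation $\otimes$ is both associative and commutative, $x \otimes x_0 = x_0$ for all $x\in X$ and $x \otimes f(x_0) = x$ for all $x \in X$ with $x \ne x_0$ (and so $f(x_0)$ is a multiplicative identity element), and the distributive law holds for $\oplus$ and $\otimes$: $$x \otimes (x_1 \oplus x_2) = (x \otimes x_1) \oplus (x \otimes x_2)$$ for all $x, x_1, x_2 \in X$. Moreover, $\otimes$ is the unique binary operation on $X$ such that (m0) $x \otimes x_0 = x_0$ for all $x \in X$; (m1) $x \otimes f(x') = x \oplus (x \otimes x')$ for all $x, x' \in X$.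
   Context: A set $E$ is finite if $\mathcal{P}(E)$ is the only subset $\mathcal{S}$ of the power set $\mathcal{P}(E)$ such that $\varnothing \in \mathcal{S}$ and $F \cup \{e\} \in \mathcal{S}$ whenever $F \in \mathcal{S}$, $F \neq E$ and $e \in E \setminus F$ (this is equivalent to the usual notion of finiteness). $\mathsf{Fin}$ denotes the (proper) class of all finite sets. An iterator is a triple $\mathbf{I} = (X,f,x_0)$ with $X$ a class (a set or a proper class), $f : X \to X$ a mapping and $x_0$ an element of $X$. The assignment of finite sets in $\mathbf{I}$ is the unique mapping $\omega : \mathsf{Fin} \to X$ with $\omega(\varnothing) = x_0$ and $\omega(A \cup \{a\}) = f(\omega(A))$ for each finite set $A$ and each element $a \notin A$. A subclass $Y$ of $X$ is $f$-invariant if $f(y) \in Y$ for all $y \in Y$. $\mathbf{I}$ is minimal if the only $f$-invariant subclass of $X$ containing $x_0$ is $X$ itself. For a minimal iterator the operation $\oplus$ of the claim exists and is unique. *)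

(* Defs.v *)
From mathcomp Require Import all_boot finmap.
From mathcomp Require Import boolp classical_sets cardinality.

Set Implicit Arguments.
Unset Strict Implicit.
Unset Printing Implicit Defensive.

Local Open Scope classical_set_scope.

(* The class of all finite sets is modelled by the finite subsets [fin T] of
   all types [T]; "[X] is a class" is modelled by [X : Type], and a subclass of
   [X] by a [set X]. *)

Definition finite_ind (T : Type) (E : set T) : Prop :=
  forall S : set (set T),
    S `<=` [set F | F `<=` E] ->
    S set0 ->
    (forall (F : set T) (e : T),
        S F -> F <> E -> (E `\` F) e -> S (F `|` [set e])) ->
    S = [set F | F `<=` E].

Lemma finite_indE (T : Type) (E : set T) : finite_ind E <-> finite_set E.
Proof.
split=> [finE|/(@finite_fsetP {classic T})[X ->] S SE S0 SU].
  have EE : [set F : set T | F `<=` E] E by [].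
  rewrite -(finE [set F | F `<=` E /\ finite_set F]) in EE.
  - by case: EE.
  - by move=> F [].
  - by split; [exact: sub0set | exact: finite_set0].
  - move=> F e [FE finF] _ [Ee _]; split; first by move=> x [/FE//|->].
    by rewrite finite_setU; split=> //; exact: finite_set1.
apply/seteqP; split=> // F FX.
have /(@finite_fsetP {classic T})[Y FY] : finite_set F.
  by apply: sub_finite_set FX _; exact: (@finite_fset {classic T}).
rewrite {F}FY in FX *; elim/fset1U_rect: Y FX => [|y Y yY IH] YX.
  by rewrite (_ : [set` fset0] = set0)//; apply/seteqP; split=> x //=; rewrite inE.
have -> : [set` (y |` Y)%fset] = [set` Y] `|` [set y] :> set {classic T}.
  apply/seteqP; split=> x /=; rewrite in_fset1U.
    by move=> /orP[/eqP->|]; [right|left].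
  by case=> [->|->]; rewrite ?eqxx ?orbT.
have Xy : y \in X by apply: YX; rewrite /= in_fset1U eqxx.
apply: SU.
- by apply: IH => x xY; apply: YX; rewrite /= in_fset1U; apply/orP; right.
- move=> YXE; move: yY; suff -> : y \in Y by [].
  by have : [set` X] y by []; rewrite -YXE.
- by split=> //=; apply/negP.
Qed.

Record fin (T : Type) := Fin { elts :> set T ; eltsP : finite_ind elts }.

Lemma fin_inj (T : Type) (A B : fin T) : A = B :> set T -> A = B.
Proof.
by case: A B => A pA [B pB] /= AB; subst B; congr Fin; exact: Prop_irrelevance.
Qed.

Lemma finite_ind0 (T : Type) : finite_ind (@set0 T).
Proof. by apply/finite_indE; exact: finite_set0. Qed.

Lemma finite_ind1 (T : Type) (a : T) : finite_ind [set a].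
Proof. by apply/finite_indE; exact: finite_set1. Qed.

Lemma finite_indU (T : Type) (A B : fin T) : finite_ind (A `|` B).
Proof.
by apply/finite_indE; rewrite finite_setU; split; apply/finite_indE; exact: eltsP.
Qed.

Lemma finite_indX (T U : Type) (A : fin T) (B : fin U) : finite_ind (A `*` B).
Proof.
by apply/finite_indE; apply: finite_setX; apply/finite_indE; exact: eltsP.
Qed.

Definition fin0 (T : Type) : fin T := Fin (@finite_ind0 T).
Definition fin1 (T : Type) (a : T) : fin T := Fin (@finite_ind1 T a).
Definition finU (T : Type) (A B : fin T) : fin T := Fin (@finite_indU T A B).
Definition finX (T U : Type) (A : fin T) (B : fin U) : fin (T * U) :=
  Fin (@finite_indX T U A B).

Record iterator := Iterator { car : Type ; succ : car -> car ; base : car }.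

Definition invariant_class (X : Type) (f : X -> X) (Y : set X) : Prop :=
  forall y, Y y -> Y (f y).

Definition minimal (I : iterator) : Prop :=
  forall Y : set (car I),
    invariant_class (@succ I) Y -> Y (base I) -> Y = setT.

Definition is_assignment (I : iterator) (w : forall T : Type, fin T -> car I) :
    Prop :=
  (forall T : Type, w T (fin0 T) = base I) /\
  (forall (T : Type) (A : fin T) (a : T),
      ~ elts A a -> w T (finU A (fin1 a)) = succ (w T A)).

Lemma assignment_exists_unique (I : iterator) :
  exists! w : forall T : Type, fin T -> car I, is_assignment w.
Proof.
pose w (T : Type) (A : fin T) : car I :=
  iter #|` fset_set (elts A : set {classic T})| (@succ I) (base I).
exists w; split.
  split=> [T|T A a Aa]; first by rewrite /w /= fset_set0 cardfs0.
  have finA : finite_set (A : set {classic T}).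
    by apply/finite_indE; exact: eltsP.
  rewrite /w /= setUC (@fset_setU1 {classic T})// cardfsU1.
  suff -> : (a : {classic T}) \notin fset_set (A : set {classic T}) by [].
  by apply/negP; rewrite in_fset_set// => /set_mem.
move=> v [v0 vS].
apply/functional_extensionality_dep => T; apply/funext => A.
have : finite_set A by apply/finite_indE; exact: eltsP.
move=> /(@finite_fsetP {classic T})[X AX].
elim/fset1U_rect: X A AX => [|x X xX IH] A AX.
  have -> : A = fin0 T.
    by apply: fin_inj; rewrite AX; apply/seteqP; split=> y //=; rewrite inE.
  by rewrite v0 /w /= fset_set0 cardfs0.
have finX : finite_ind ([set` X] : set {classic T}).
  by apply/finite_indE; exact: finite_fset.
have -> : A = finU (Fin finX) (fin1 (x : T)).
  apply: fin_inj; rewrite AX; apply/seteqP; split=> y /=; rewrite in_fset1U.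
    by move=> /orP[/eqP->|]; [right|left].
  by case=> [->|->]; rewrite ?eqxx ?orbT.
rewrite vS/=; last exact/negP.
rewrite -(IH (Fin finX))// /w /= setUC (@fset_setU1 {classic T}) ?set_fsetK//.
  by rewrite cardfsU1 xX.
exact: finite_fset.
Qed.

Definition is_sum (I : iterator) (w : forall T : Type, fin T -> car I)
    (op : car I -> car I -> car I) : Prop :=
  forall (T : Type) (A B : fin T),
    A `&` B = set0 -> op (w T A) (w T B) = w T (finU A B).

Definition is_product (I : iterator) (w : forall T : Type, fin T -> car I)
    (op : car I -> car I -> car I) : Prop :=
  forall (T U : Type) (A : fin T) (B : fin U),
    op (w T A) (w U B) = w (T * U)%type (finX A B).

(* Main.v *)
Require Import Defs.
From mathcomp Require Import all_boot.
From mathcomp Require Import boolp classical_sets cardinality.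

(** The multiplication is the cartesian product of finite sets seen
    through [omega], and every algebraic law is the image of a set-theoretic
    one.

    By minimality each element of [car I] is [omega A] for a finite set [A] of
    natural numbers, so [mul x y] can be taken to be the [omega] of the product
    of two representatives.  The point is that this does not depend on the
    representatives ([omegaX_congr]).  Splitting off the slice of the product
    above one point of [B] gives
      [omega (A `*` (B `|` [set b])) = add (omega A) (omega (A `*` B))],
    so, by induction on [B], the value [omega (A `*` B)] depends on [A] only
    through [omega A]; and [omega] is invariant under injections
    ([omega_image]), in particular under the exchange of factors, so the same
    holds for [B].  Arguing with [omega] rather than with cardinals matters,
    because sets of different cardinals may have the same [omega]: a minimal
    iterator can be finite.

    Commutativity and associativity are then the canonical bijections between
    products, distributivity is the distribution of [`*`] over disjoint unions,
    and the recursion [mul x (succ x') = add x (mul x x')] is the splitting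
    above.  Representatives can be chosen disjoint
    from a given finite set ([omega_surj_avoiding]), which is what allows [add]
    to be read as a union.  Uniqueness from the product rule holds because
    [omega] is onto, and uniqueness from the recursion is minimality
    again. *)

Set Implicit Arguments.
Unset Strict Implicit.
Unset Printing Implicit Defensive.

Local Open Scope classical_set_scope.

(** * Finite sets *)

(** The family to which [finite_ind] applies has to consist of plain sets, so
    finiteness of its members is carried inside it. *)
Lemma fin_ind (T : Type) (P : fin T -> Prop) :
    P (fin0 T) ->
    (forall (A : fin T) (a : T), ~ elts A a -> P A -> P (finU A (fin1 a))) ->
  forall A, P A.
Proof.
move=> P0 PU A.
have := eltsP (f := A).
move=> /(_ [set F | F `<=` A /\ exists2 B : fin T, B = F :> set T & P B]) S.
have : [set F : set T | F `<=` A] A by [].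
rewrite -S => [[_ [B /fin_inj <-]]//|F []//||F a [FA [B BF PB]] _ [Aa Fa]].
  by split; [exact: sub0set | exists (fin0 T)].
split; first by rewrite subUset; split=> // _ ->.
exists (finU B (fin1 a)); first by rewrite -BF.
by apply: PU => //; rewrite BF.
Qed.

Lemma finite_ind_image (T U : Type) (f : T -> U) (A : fin T) :
  finite_ind (f @` A).
Proof.
by apply/finite_indE; apply: finite_image; apply/finite_indE; exact: eltsP.
Qed.

Definition fin_image (T U : Type) (f : T -> U) (A : fin T) : fin U :=
  Fin (@finite_ind_image T U f A).

Lemma fin_nat_fresh (A : fin nat) : exists n, ~ elts A n.
Proof.
apply: contrapT => /forallNP An; apply: infinite_nat.
suff <- : elts A = setT by apply/finite_indE; exact: eltsP.
by apply/seteqP; split=> // n _; exact: contrapT (An n).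
Qed.

Lemma finX0 (T U : Type) (A : fin T) : finX A (fin0 U) = fin0 (T * U).
Proof. by apply: fin_inj; exact: setX0. Qed.

Lemma finXU (T U : Type) (A : fin T) (B C : fin U) :
  finX A (finU B C) = finU (finX A B) (finX A C).
Proof.
apply: fin_inj; apply/seteqP; split=> -[a b] /=.
  by case=> Aa [Bb|Cb]; [left|right].
by case=> -[Aa ?]; split=> //; [left|right].
Qed.

Lemma finX_disjoint (T U : Type) (A : fin T) (B C : fin U) :
  B `&` C = set0 -> finX A B `&` finX A C = set0.
Proof.
move=> BC; apply/seteqP; split=> // -[a b] [[_ Bb] [_ Cb]].
by have : (B `&` C) b by []; rewrite BC.
Qed.

Lemma finUC (T : Type) (A B : fin T) : finU A B = finU B A.
Proof. by apply: fin_inj; exact: setUC. Qed.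

Lemma disjoint_fin1 (T : Type) (A : fin T) (a : T) :
  ~ elts A a -> fin1 a `&` A = set0.
Proof. by move=> Aa; apply/seteqP; split=> // _ [-> /Aa]. Qed.

(** * The assignment of finite sets *)

Section Assignment.
Variables (I : iterator) (omega : forall T : Type, fin T -> car I).
Hypothesis omegaP : is_assignment omega.

Let omega0 (T : Type) : omega (fin0 T) = base I.
Proof. by case: omegaP. Qed.

Let omegaS (T : Type) (A : fin T) (a : T) :
  ~ elts A a -> omega (finU A (fin1 a)) = succ (omega A).
Proof. by case: omegaP => _; apply. Qed.

(** The assignment only sees how a set is built up point by point, and an
    injection carries such a construction of [A] to one of its image.  Every
    bijection between products used below is an instance. *)
Lemma omega_image (T U : Type) (f : T -> U) (A : fin T) :
  injective f -> omega (fin_image f A) = omega A.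
Proof.
move=> finj; elim/fin_ind: A => [|A a Aa IH].
  rewrite omega0 -(omega0 U); congr omega; apply: fin_inj; exact: image_set0.
rewrite omegaS// -IH.
rewrite -(@omegaS _ _ (f a)); last by case=> a' Aa' /finj aa'; apply: Aa; rewrite -aa'.
by congr omega; apply: fin_inj; rewrite /= image_setU image_set1.
Qed.

Lemma omega1 (T : Type) (a : T) : omega (fin1 a) = succ (base I).
Proof.
rewrite -(omega0 T) -(@omegaS _ _ a)//; congr omega; apply: fin_inj.
by rewrite /= set0U.
Qed.

Lemma omegaX1 (T U : Type) (A : fin T) (b : U) :
  omega (finX A (fin1 b)) = omega A.
Proof.
rewrite -(@omega_image _ _ (fun a => (a, b)) A) => [|? ? []//].
congr omega; apply: fin_inj; apply/seteqP; split=> -[a c] /=.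
  by move=> [Aa ->]; exists a.
by move=> [a' Aa' [<- <-]].
Qed.

Lemma omegaXC (T U : Type) (A : fin T) (B : fin U) :
  omega (finX A B) = omega (finX B A).
Proof.
rewrite -(@omega_image _ _ (fun p => (p.2, p.1)) (finX A B)); last first.
  by move=> [? ?] [? ?] [-> ->].
congr omega; apply: fin_inj; apply/seteqP; split=> -[b a] /=.
  by move=> [[a' b'] [Aa' Bb'] [<- <-]].
by move=> [Bb Aa]; exists (a, b).
Qed.

Lemma omegaXA (T U V : Type) (A : fin T) (B : fin U) (C : fin V) :
  omega (finX A (finX B C)) = omega (finX (finX A B) C).
Proof.
rewrite -(@omega_image _ _ (fun p => ((p.1, p.2.1), p.2.2)) (finX A _)).
  congr omega; apply: fin_inj; apply/seteqP; split=> -[[a b] c] /=.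
    by move=> [[a' [b' c']] [Aa' [Bb' Cc']] [<- <- <-]].
  by move=> [[Aa Bb] Cc]; exists (a, (b, c)).
by move=> [? [? ?]] [? [? ?]] [-> -> ->].
Qed.

(** Representatives are taken among sets of natural numbers because there a
    finite set always leaves room for one more point. *)
Lemma omega_surj_avoiding (A : fin nat) (x : car I) :
  minimal I -> exists2 B : fin nat, A `&` B = set0 & omega B = x.
Proof.
move=> Imin.
pose Y := [set x | exists2 B : fin nat, A `&` B = set0 & omega B = x].
suff : Y x by [].
rewrite (Imin Y)//; last by exists (fin0 nat); [exact: setI0 | exact: omega0].
move=> _ [B AB <-]; have [n] := fin_nat_fresh (finU A B).
move=> /not_orP[An Bn]; exists (finU B (fin1 n)); last exact: omegaS.
by rewrite /= setIUr AB set0U setIC; exact: disjoint_fin1.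
Qed.

(** * Values of the assignment on products *)

Variable add : car I -> car I -> car I.
Hypothesis addP : is_sum omega add.

Lemma omegaXU (T U : Type) (A : fin T) (B C : fin U) :
    B `&` C = set0 ->
  omega (finX A (finU B C)) = add (omega (finX A B)) (omega (finX A C)).
Proof. by move=> BC; rewrite finXU addP//; exact: finX_disjoint. Qed.

Lemma omegaXS (T U : Type) (A : fin T) (B : fin U) (b : U) :
    ~ elts B b ->
  omega (finX A (finU B (fin1 b))) = add (omega A) (omega (finX A B)).
Proof.
by move=> Bb; rewrite finUC omegaXU ?omegaX1//; exact: disjoint_fin1.
Qed.

Lemma omegaX_congrl (T T' U : Type) (A : fin T) (A' : fin T') (B : fin U) :
  omega A = omega A' -> omega (finX A B) = omega (finX A' B).
Proof.
move=> AA'; elim/fin_ind: B => [|B b Bb IH].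
  by rewrite !finX0 !omega0.
by rewrite !omegaXS// AA' IH.
Qed.

(** This is what makes the product of two elements of [car I] well defined;
    the second factor is reduced to the first by exchanging the factors. *)
Lemma omegaX_congr (T T' U U' : Type) (A : fin T) (A' : fin T')
    (B : fin U) (B' : fin U') :
    omega A = omega A' -> omega B = omega B' ->
  omega (finX A B) = omega (finX A' B').
Proof.
move=> /omegaX_congrl-> BB'; rewrite omegaXC (omegaX_congrl _ BB').
exact: omegaXC.
Qed.

End Assignment.

Theorem theorem10p2 (I : iterator) (omega : forall T : Type, fin T -> car I)
    (add : car I -> car I -> car I)
    (Imin : minimal I)
    (omegaP : is_assignment omega)
    (addP : is_sum omega add) :
  exists mul : car I -> car I -> car I,
    unique (is_product omega) mul /\
    associative mul /\
    commutative mul /\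
    (forall x, mul x (base I) = base I) /\
    (forall x, x <> base I -> mul x (succ (base I)) = x) /\
    left_id (succ (base I)) mul /\
    right_id (succ (base I)) mul /\
    (forall x x1 x2, mul x (add x1 x2) = add (mul x x1) (mul x x2)) /\
    unique
      (fun op : car I -> car I -> car I =>
         (forall x, op x (base I) = base I) /\
         (forall x x', op x (succ x') = add x (op x x')))
      mul.
Proof.
have [omega0 omegaS] := omegaP.
have surj x : exists A : fin nat, omega nat A = x.
  by have [A _ Ax] := omega_surj_avoiding omegaP (fin0 nat) x Imin; exists A.
have [rep repK] := choice surj.
pose mul x y := omega _ (finX (rep x) (rep y)).
have mulP : is_product omega mul.
  by move=> T U A B; apply: (omegaX_congr omegaP addP); rewrite repK.
have mulC : commutative mul by move=> x y; exact: omegaXC.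
have mulx0 x : mul x (base I) = base I.
  by rewrite -(repK x) -(omega0 nat) mulP finX0 !omega0.
have mulx1 : right_id (succ (base I)) mul.
  by move=> x; rewrite -(repK x) -(omega1 omegaP 0) mulP omegaX1.
have mulxS x y : mul x (succ y) = add x (mul x y).
  have [A <-] := surj x; have [B <-] := surj y.
  have [n Bn] := fin_nat_fresh B.
  by rewrite -(omegaS _ _ n)// !mulP (omegaXS omegaP addP).
exists mul; split.
  split=> // op opP; apply/funext => x; apply/funext => y.
  by rewrite -(repK x) -(repK y) mulP opP.
split.
  move=> x y z; have [A <-] := surj x; have [B <-] := surj y.
  by have [C <-] := surj z; rewrite !mulP; exact: omegaXA.
split=> //; split=> //; split=> [x _|]; first exact: mulx1.
split=> [x|]; first by rewrite mulC mulx1.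
split=> //; split.
  move=> x y z; have [A <-] := surj x; have [B <-] := surj y.
  have [C BC <-] := omega_surj_avoiding omegaP B z Imin.
  by rewrite addP// !mulP (omegaXU addP).
split=> // op [op0 opS]; apply/funext => x; apply/funext => y.
suff : [set y | mul x y = op x y] y by [].
rewrite (Imin [set y | mul x y = op x y])//=; last by rewrite mulx0 op0.
by move=> z /= mulz; rewrite mulxS opS mulz.
Qed.
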